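(* Let $f^{n+1}=f^{(3)}$ be obtained from $f^n$ by the three-stage type CK, globally stiffly accurate, ARS IMEX-RK scheme $$\begin{aligned} f^{(1)}&=f^n,\qquad f^{(2)}=\mathcal S_{2,0}[f^n]+\frac{\Delta t}{\varepsilon}a_1\mathcal S_{2,1}[G_P(f^{(1)})]+\frac{\Delta t}{\varepsilon}\tilde{\hat a}_{11}Q_P(f^{(2)}),\\ f^{(3)}&=\mathcal S_{3,0}[f^n]+\frac{\Delta t}{\varepsilon}a_2\mathcal S_{3,1}[G_P(f^{(1)})]+\frac{\Delta t}{\varepsilon}\hat a_{21}\mathcal S_{3,2}[G_P(f^{(2)})]+\frac{\Delta t}{\varepsilon}\tilde{\hat a}_{21}\mathcal S_{3,2}[Q_P(f^{(2)})]+\frac{\Delta t}{\varepsilon}\tilde{\hat a}_{22}Q_P(f^{(3)}). \end{aligned}$$ Assume $f^n\ge0$ and $G_P(f^n)\ge0$. Put $z=\frac{\beta\Delta t}{\varepsilon}>0$. Then a sufficient condition to ensure $f^{n+1}\ge0$ is $$\begin{cases} a_1\ge0,\quad \tilde{\hat a}_{11}>0,\quad \hat a_{21}\ge0,\quad \tilde{\hat a}_{22}>0,\\[4pt] 1-\dfrac{z\tilde{\hat a}_{21}}{1+z\tilde{\hat a}_{11}}\ge0,\quad a_2-\dfrac{z\tilde{\hat a}_{21}a_1}{1+z\tilde{\hat a}_{11}}\ge0,\quad -\hat a_{21}+\tilde{\hat a}_{21}-\dfrac{z\tilde{\hat a}_{21}\tilde{\hat a}_{11}}{1+z\tilde{\hat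 a}_{11}}\ge0 . \end{cases}$$
   Context: Semi-discrete (in time) scheme for the Boltzmann equation $\partial_t f+v\,\partial_x f=\frac1\varepsilon Q(f)$ with constant $\varepsilon>0$, one-dimensional space variable $x$, velocity in $\mathbb R^{d_v}$ (in shifts $v$ is the first velocity component). $Q(f)(v)=\int_{\mathbb R^{d_v}}\int_{\mathbb S^{d_v-1}}\mathcal B(|v-v_*|,\sigma)[f(v')f(v'_* )-f(v)f(v_* )]\,d\sigma\,dv_*$ with $v'=\frac{v+v_*}2+\frac{|v-v_*|}2\sigma$, $v'_*=\frac{v+v_*}2-\frac{|v-v_*|}2\sigma$, and $\int Q(f)\phi\,dv=0$ for $\phi=(1,v,|v|^2)^\top$. $\mathcal M[f]=\frac{\rho}{(2\pi T)^{d_v/2}}\exp(-\frac{|v-u|^2}{2T})$ is the Maxwellian having the same moments $\int f\phi\,dv$ as $f$ (density $\rho$, bulk velocity $u$, temperature $T$). The penalization parameter $\beta>0$ is the same constant in all stages, and is chosen so that $P(f):=Q(f)+\beta f\ge0$ whenever $f\ge0$. One has $Q_P(f)=\beta(\mathcal M[f]-f)$ and $G_P(f)=Q(f)-Q_P(f)=P(f)-\beta\mathcal M[f]$. $\mathcal S_{i,j}[f](x,v)=f(x-(c_i-c_j)v\Delta t,v)$ with $c_0=0$, where $c_i$ are the stage abscissae (with $c_1=0$), the same for the explicit and implicit tableaux. The tableaux matrices are $A=\begin{pmatrix}0&0\\ a&\hat A\end{pmatrix}$, $\tilde A=\begin{pmatrix}0&0\\ 0&\tilde{\hat A}\end{pmatrix}\in\mathbb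 R^{3\times3}$ (type CK with ARS property: the first column of $\tilde A$ and first implicit weight vanish), with $a=(a_1,a_2)^\top$, $\hat A=(\hat a_{ij})$ strictly lower triangular, $\tilde{\hat A}=(\tilde{\hat a}_{ij})$ lower triangular and invertible. Globally stiffly accurate (GSA) means that the last rows of the tableaux equal the weights, so $f^{n+1}=f^{(3)}$. The stage values are assumed to be well defined. *)

(* Defs.v *)
From HB Require Import structures.
From mathcomp Require Import all_boot all_order all_algebra.
From mathcomp Require Import all_classical all_reals all_analysis.
From mathcomp Require Import measurable_realfun.

Set Implicit Arguments.
Unset Strict Implicit.
Unset Printing Implicit Defensive.
Import Order.TTheory GRing.Theory Num.Theory.
Import numFieldNormedType.Exports.

Local Open Scope classical_set_scope.
Local Open Scope ring_scope.

Definition tuple_cons (R : realType) (n : nat)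
    (p : measurableTypeR R * n.-tuple R) : n.+1.-tuple R :=
  [tuple of p.1 :: p.2].

Lemma measurable_tuple_cons (R : realType) (n : nat) :
  measurable_fun setT (@tuple_cons R n).
Proof. by apply: measurable_cons; [exact: measurable_fst|exact: measurable_snd]. Qed.

Definition lebesgue_cons (R : realType) (n : nat)
    (m : set (n.-tuple R) -> \bar R) : set (n.+1.-tuple R) -> \bar R :=
  pushforward (@lebesgue_measure R \x m)%E (@tuple_cons R n).

Section lebesgue_cons_measure.
Variables (R : realType) (n : nat)
  (m : {sigma_finite_measure set (n.-tuple R) -> \bar R}).

Let lebesgue_cons0 : lebesgue_cons m set0 = 0%E.
Proof. by rewrite /lebesgue_cons /pushforward preimage_set0 measure0. Qed.

Let lebesgue_cons_ge0 A : (0 <= lebesgue_cons m A)%E.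
Proof. by rewrite /lebesgue_cons /pushforward; exact: measure_ge0. Qed.

Let lebesgue_cons_sigma_additive : semi_sigma_additive (lebesgue_cons m).
Proof.
move=> F mF tF mUF; rewrite /lebesgue_cons /pushforward preimage_bigcup.
have mpre A : measurable A -> measurable (@tuple_cons R n @^-1` A).
  by move=> mA; rewrite -[X in measurable X]setTI; exact: measurable_tuple_cons.
apply: measure_semi_sigma_additive => //.
- by move=> k; exact: mpre.
- apply/trivIsetP => /= i j _ _ ij; rewrite -preimage_setI.
  by move/trivIsetP : tF => /(_ _ _ _ _ ij) ->//; rewrite preimage_set0.
- by rewrite -preimage_bigcup; exact: mpre.
Qed.

HB.instance Definition _ := isMeasure.Build _ _ _ (lebesgue_cons m)
  lebesgue_cons0 lebesgue_cons_ge0 lebesgue_cons_sigma_additive.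

Let lebesgue_cons_sigma_finite : sigma_finite setT (lebesgue_cons m).
Proof.
have /sigma_finiteP[F [UF ndF mF]] := sigma_finiteT (@lebesgue_measure R).
have /sigma_finiteP[G [UG ndG mG]] := sigma_finiteT m.
pose uncons (t : n.+1.-tuple R) : measurableTypeR R * n.-tuple R :=
  (thead t, [tuple of behead t]).
have unconsK : cancel (@tuple_cons R n) uncons.
  by move=> [x t]; congr pair; apply: val_inj.
have muncons : measurable_fun setT uncons.
  apply/measurable_fun_pairP; split; first exact: (@measurable_tnth _ R).
  exact: measurable_behead.
exists (fun k => uncons @^-1` (F k `*` G k)).
  rewrite -preimage_bigcup; apply/seteqP; split => // t _ /=.
  have [i _ Fi] : (\bigcup_i F i) (thead t) by rewrite -UF.
  have [j _ Gj] : (\bigcup_i G i) [tuple of behead t] by rewrite -UG.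
  exists (maxn i j) => //; split => /=.
  - by move: Fi; exact/subsetPset/ndF/leq_maxl.
  - by move: Gj; exact/subsetPset/ndG/leq_maxr.
move=> k; have [mFk Fkoo] := mF k; have [mGk Gkoo] := mG k; split.
  by rewrite -[X in measurable X]setTI; apply: muncons => //; exact: measurableX.
rewrite /lebesgue_cons /pushforward -comp_preimage.
rewrite (_ : uncons \o _ = id); last by apply/funext => p /=; exact: unconsK.
by rewrite preimage_id product_measure1E// lte_mul_pinfty// ge0_fin_numE.
Qed.

HB.instance Definition _ := Measure_isSigmaFinite.Build _ _ _ (lebesgue_cons m)
  lebesgue_cons_sigma_finite.

End lebesgue_cons_measure.

Fixpoint lebesgue (R : realType) (n : nat) :
    {sigma_finite_measure set (n.-tuple R) -> \bar R} :=
  match n with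
  | 0 => \d_([tuple] : 0.-tuple R)
  | k.+1 => lebesgue_cons (lebesgue R k)
  end.

Definition eucl_norm (R : realType) (n : nat) (v : n.-tuple R) : R :=
  Num.sqrt (\sum_(i < n) tnth v i ^+ 2).

Definition eucl_dist (R : realType) (n : nat) (v w : n.-tuple R) : R :=
  Num.sqrt (\sum_(i < n) (tnth v i - tnth w i) ^+ 2).

Definition direction (R : realType) (n : nat) (w : n.-tuple R) : n.-tuple R :=
  [tuple tnth w i / eucl_norm w | i < n].

Definition punctured_ball (R : realType) (n : nat) : set (n.-tuple R) :=
  [set w | 0 < eucl_norm w <= 1].

Lemma measurable_eucl_norm (R : realType) (n : nat) :
  measurable_fun setT (@eucl_norm R n).
Proof.
rewrite (_ : @eucl_norm R n =
    (fun x => x `^ 2^-1) \o fun v => \sum_(i < n) tnth v i ^+ 2); last first.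
  by apply/funext => v /=; rewrite powR12_sqrt// sumr_ge0// => i _; exact: sqr_ge0.
apply: measurableT_comp; first exact: measurable_powR.
apply: measurable_sum => i.
by apply: measurable_funX; exact: measurable_tnth.
Qed.

Lemma measurable_direction (R : realType) (n : nat) :
  measurable_fun setT (@direction R n).
Proof.
apply/measurable_fun_tnthP => i.
rewrite (_ : _ \o _ =
    fun w : n.-tuple R => tnth w i * eucl_norm w `^ (-1)); last first.
  by apply/funext => w /=; rewrite tnth_mktuple powR_inv1// sqrtr_ge0.
apply: measurable_funM; first exact: measurable_tnth.
by apply: (measurableT_comp (measurable_powR _)); exact: measurable_eucl_norm.
Qed.

Lemma measurable_punctured_ball (R : realType) (n : nat) :
  measurable (@punctured_ball R n).
Proof.
rewrite (_ : @punctured_ball R n = @eucl_norm R n @^-1` `]0, 1]%classic).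
  by rewrite -[X in measurable X]setTI; exact: measurable_eucl_norm.
by apply/seteqP; split => w /=; rewrite in_itv.
Qed.

(* The surface measure is recovered from Lebesgue measure by polar coordinates:
   the part of the unit ball above a set A of directions has volume
   sigma(A) / n.  For n = 1 it is the counting measure on {-1, 1}. *)
Definition sphere_measure (R : realType) (n : nat) (A : set (n.-tuple R)) : \bar R :=
  (n%:R%:E * lebesgue R n (@punctured_ball R n `&` @direction R n @^-1` A))%E.

Section sphere_measure_measure.
Variables (R : realType) (n : nat).

Let cone (A : set (n.-tuple R)) := @punctured_ball R n `&` @direction R n @^-1` A.

Let measurable_cone A : measurable A -> measurable (cone A).
Proof.
move=> mA; apply: measurableI; first exact: measurable_punctured_ball.
by rewrite -[X in measurable X]setTI; exact: measurable_direction.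
Qed.

Let sphere_measure0 : @sphere_measure R n set0 = 0%E.
Proof. by rewrite /sphere_measure preimage_set0 setI0 measure0 mule0. Qed.

Let sphere_measure_ge0 A : (0 <= @sphere_measure R n A)%E.
Proof. by rewrite /sphere_measure mule_ge0// lee_fin. Qed.

Let sphere_measure_sigma_additive : semi_sigma_additive (@sphere_measure R n).
Proof.
move=> F mF tF mUF.
have n0 : 0 <= n%:R :> R by [].
rewrite /sphere_measure preimage_bigcup setI_bigcupr.
apply: (@measure_semi_sigma_additive _ _ _ (mscale (NngNum n0) (lebesgue R n))
  (cone \o F)) => /=.
- by move=> k; exact: measurable_cone.
- apply/trivIsetP => /= i j _ _ ij; rewrite /cone setIACA -preimage_setI.
  move/trivIsetP : tF => /(_ _ _ _ _ ij) ->//.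
  by rewrite preimage_set0 setI0.
- by apply: bigcupT_measurable => k; exact: measurable_cone.
Qed.

HB.instance Definition _ := isMeasure.Build _ _ _ (@sphere_measure R n)
  sphere_measure0 sphere_measure_ge0 sphere_measure_sigma_additive.

End sphere_measure_measure.

Definition post_velocity (R : realType) (n : nat) (v w s : n.-tuple R) : n.-tuple R :=
  [tuple (tnth v i + tnth w i) / 2 + eucl_dist v w / 2 * tnth s i | i < n].

Definition post_velocity_star (R : realType) (n : nat) (v w s : n.-tuple R) :
    n.-tuple R :=
  [tuple (tnth v i + tnth w i) / 2 - eucl_dist v w / 2 * tnth s i | i < n].

Definition collision_integrand (R : realType) (n : nat)
    (B : R -> n.-tuple R -> R) (f : n.-tuple R -> R) (v w s : n.-tuple R) : R :=
  B (eucl_dist v w) s *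
    (f (post_velocity v w s) * f (post_velocity_star v w s) - f v * f w).

Definition boltzmann (R : realType) (n : nat)
    (B : R -> n.-tuple R -> R) (f : n.-tuple R -> R) (v : n.-tuple R) : R :=
  \int[lebesgue R n]_w \int[@sphere_measure R n]_s collision_integrand B f v w s.

Definition boltzmann_defined (R : realType) (n : nat)
    (B : R -> n.-tuple R -> R) (f : n.-tuple R -> R) : Prop :=
  forall v, (@sphere_measure R n \x lebesgue R n)%E.-integrable setT
    (fun p => (collision_integrand B f v p.2 p.1)%:E).

Definition mass (R : realType) (n : nat) (f : n.-tuple R -> R) : R :=
  \int[lebesgue R n]_v f v.

Definition momentum (R : realType) (n : nat) (f : n.-tuple R -> R) (i : 'I_n) : R :=
  \int[lebesgue R n]_v (tnth v i * f v).

Definition energy (R : realType) (n : nat) (f : n.-tuple R -> R) : R :=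
  \int[lebesgue R n]_v (eucl_norm v ^+ 2 * f v).

Definition finite_moments (R : realType) (n : nat) (f : n.-tuple R -> R) : Prop :=
  [/\ (lebesgue R n).-integrable setT (EFin \o f),
      forall i, (lebesgue R n).-integrable setT (fun v => (tnth v i * f v)%:E) &
      (lebesgue R n).-integrable setT (fun v => (eucl_norm v ^+ 2 * f v)%:E)].

(* Conservation of mass, momentum and energy, required of those f for which the
   weak form of the collision operator converges absolutely. *)
Definition conservative (R : realType) (n : nat) (B : R -> n.-tuple R -> R) : Prop :=
  forall f : n.-tuple R -> R,
    ((@sphere_measure R n \x lebesgue R n) \x lebesgue R n)%E.-integrable setT
      (fun p => (collision_integrand B f p.2 p.1.2 p.1.1
                 * (1 + eucl_norm p.2 ^+ 2))%:E) ->
    [/\ mass (boltzmann B f) = 0,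
        forall i, momentum (boltzmann B f) i = 0 &
        energy (boltzmann B f) = 0].

Definition bulk_velocity (R : realType) (n : nat) (f : n.-tuple R -> R) : n.-tuple R :=
  [tuple momentum f i / mass f | i < n].

Definition temperature (R : realType) (n : nat) (f : n.-tuple R -> R) : R :=
  (\int[lebesgue R n]_v (eucl_dist v (bulk_velocity f) ^+ 2 * f v))
    / (n%:R * mass f).

Definition maxwellian (R : realType) (n : nat) (f : n.-tuple R -> R)
    (v : n.-tuple R) : R :=
  mass f / (2 * pi * temperature f) `^ (n%:R / 2)
    * expR (- (eucl_dist v (bulk_velocity f) ^+ 2 / (2 * temperature f))).

(* Condition for a Maxwellian with the moments of f to exist, where a negative
   density is not excluded.  In vacuum, where the temperature is undefined,
   [maxwellian f] evaluates to 0 thanks to the factor [mass f]. *)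
Definition maxwellian_defined (R : realType) (n : nat) (f : n.-tuple R -> R) : Prop :=
  finite_moments f /\
  ([/\ mass f = 0, forall i, momentum f i = 0 & energy f = 0] \/
   (mass f != 0 /\ 0 < temperature f)).

Definition P_op (R : realType) (n : nat) (B : R -> n.-tuple R -> R) (beta : R)
    (f : n.-tuple R -> R) (v : n.-tuple R) : R :=
  boltzmann B f v + beta * f v.

Definition Q_P (R : realType) (n : nat) (beta : R)
    (f : n.-tuple R -> R) (v : n.-tuple R) : R :=
  beta * (maxwellian f v - f v).

Definition G_P (R : realType) (n : nat) (B : R -> n.-tuple R -> R) (beta : R)
    (f : n.-tuple R -> R) (v : n.-tuple R) : R :=
  boltzmann B f v - Q_P beta f v.

(* Only the first component of the velocity transports in the space variable. *)
Definition transport_shift (R : realType) (d : nat) (c : nat -> R) (dt : R) (i j : nat)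
    (f : R -> d.+1.-tuple R -> R) (x : R) (v : d.+1.-tuple R) : R :=
  f (x - (c i - c j) * thead v * dt) v.

Definition nonneg (R : realType) (n : nat) (f : R -> n.-tuple R -> R) : Prop :=
  forall x v, 0 <= f x v.

(* The implication f >= 0 -> P(f) >= 0 for one given distribution f.  Quantified
   over every f it would be too strong: Q is quadratic, so imposing it on all
   multiples of f with the same beta forces Q(f) >= 0. *)
Definition penalization_admissible (R : realType) (n : nat)
    (B : R -> n.-tuple R -> R) (beta : R) (f : R -> n.-tuple R -> R) : Prop :=
  nonneg f -> nonneg (fun x => P_op B beta (f x)).

(* Main.v *)
(* Each implicit stage has the form (1 + w) f = h + w M[f] with h >= 0.  Since
   M[f] has the mass of f, integrating over v gives mass f = mass h >= 0; as the
   sign of M[f] is that of the mass of f, M[f] >= 0 and then f >= 0.  For the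
   last stage, eliminating the transported f2 through the second stage makes h a
   combination of fn, G_P(fn), P(f2) and M[f2] whose coefficients are, up to
   positive factors, the quantities assumed nonnegative. *)
Require Import Defs.
From HB Require Import structures.
From mathcomp Require Import all_boot all_order all_algebra.
From mathcomp Require Import all_classical all_reals all_analysis.
From mathcomp Require Import measurable_realfun.
From mathcomp Require Import ring lra.

Set Implicit Arguments.
Unset Strict Implicit.
Unset Printing Implicit Defensive.
Import Order.TTheory GRing.Theory Num.Theory.
Import numFieldNormedType.Exports.

Local Open Scope classical_set_scope.
Local Open Scope ring_scope.

Lemma measurable_prod_tnth (R : realType) (n : nat) (g : 'I_n -> R -> R) :
  (forall i, measurable_fun [set: R] (g i)) ->
  measurable_fun [set: n.-tuple R] (fun v => \prod_(i < n) g i (tnth v i)).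
Proof.
move=> mg; apply: measurable_prod => i _.
by apply: (measurableT_comp (mg i)); exact: measurable_tnth.
Qed.

(** Induction on the dimension: the measure on tuples is a pushforward of a product, and Tonelli
    splits off the first coordinate. In dimension 0 the measure is a Dirac mass and the empty
    product is 1. *)
Lemma integral_lebesgue_prod (R : realType) (n : nat) (g : 'I_n -> R -> R)
    (k : 'I_n -> R) :
  (forall i, measurable_fun [set: R] (g i)) -> (forall i x, 0 <= g i x) ->
  (forall i, \int[lebesgue_measure]_x (g i x)%:E = (k i)%:E)%E ->
  (\int[lebesgue R n]_v (\prod_(i < n) g i (tnth v i))%:E
    = (\prod_(i < n) k i)%:E)%E.
Proof.
elim: n g k => [|n IH] g k mg g0 ig.
  rewrite integral_dirac//=; last first.
    by under eq_fun do rewrite big_ord0; exact: measurable_cst.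
  by rewrite diracT mul1e !big_ord0.
rewrite /= ge0_integral_pushforward//=; last 3 first.
- exact: measurable_tuple_cons.
- by apply/measurable_EFinP; exact: measurable_prod_tnth.
- by move=> v _; rewrite lee_fin prodr_ge0.
rewrite preimage_setT fubini_tonelli1/=; last 2 first.
- apply/measurable_EFinP; apply: (measurableT_comp (measurable_prod_tnth mg)).
  exact: measurable_tuple_cons.
- by move=> v; rewrite lee_fin prodr_ge0.
rewrite /fubini_F.
transitivity (\int[lebesgue_measure]_x
    ((\prod_(i < n) k (lift ord0 i))%:E * (g ord0 x)%:E))%E.
  apply: eq_integral => x _.
  rewrite -(IH (fun i => g (lift ord0 i)))// muleC -ge0_integralZl//; last 3 first.
  - apply/measurable_EFinP; apply: (@measurable_prod_tnth _ _ (fun i => g (lift ord0 i))) => i.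
    exact: mg.
  - by move=> v _; rewrite lee_fin prodr_ge0.
  - by rewrite lee_fin.
  apply: eq_integral => v _; rewrite /= big_ord_recl tnth0 EFinM.
  by congr (_ * _%:E)%E; apply: eq_bigr => i _; rewrite tnthS.
rewrite ge0_integralZl//; last 3 first.
- by apply/measurable_EFinP; exact: mg.
- by move=> x _; rewrite lee_fin.
- rewrite lee_fin prodr_ge0// => i _.
  by rewrite -lee_fin -ig integral_ge0// => x _; rewrite lee_fin.
by rewrite ig big_ord_recl mulrC EFinM.
Qed.

Lemma integral_prod_normal_pdf (R : realType) (n : nat) (u : n.-tuple R) (s : R) :
  (\int[lebesgue R n]_v (\prod_(i < n) normal_pdf (tnth u i) s (tnth v i))%:E
    = 1)%E.
Proof.
rewrite (@integral_lebesgue_prod _ _ (fun i => normal_pdf (tnth u i) s) (fun=> 1)) ?big1// => i *.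
- exact: measurable_normal_pdf.
- exact: normal_pdf_ge0.
- exact: integral_normal_pdf.
Qed.

Lemma integrable_prod_normal_pdf (R : realType) (n : nat) (u : n.-tuple R) (s : R) :
  (lebesgue R n).-integrable setT
    (fun v => (\prod_(i < n) normal_pdf (tnth u i) s (tnth v i))%:E).
Proof.
apply/integrableP; split.
  apply/measurable_EFinP.
  apply: (@measurable_prod_tnth _ _ (fun i => normal_pdf (tnth u i) s)) => i.
  exact: measurable_normal_pdf.
under eq_integral => v _.
  rewrite gee0_abs; last by rewrite lee_fin prodr_ge0// => i _; exact: normal_pdf_ge0.
  over.
by rewrite integral_prod_normal_pdf ltry.
Qed.

(** The exponential of a sum over coordinates is a product, and (2 pi T)^(n/2) is the n-th power of
    the one-dimensional constant. Integrals of Maxwellians thus reduce to one-dimensional Gaussian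
    ones with variance T. *)
Lemma maxwellian_prod_normal_pdf (R : realType) (n : nat) (f : n.-tuple R -> R)
    (v : n.-tuple R) : 0 < temperature f ->
  maxwellian f v = mass f *
    \prod_(i < n) normal_pdf (tnth (bulk_velocity f) i)
      (Num.sqrt (temperature f)) (tnth v i).
Proof.
set T := temperature f; set u := bulk_velocity f => T0.
have sT0 : Num.sqrt T != 0 by rewrite gt_eqF// sqrtr_gt0.
under eq_bigr do rewrite normal_pdfE//.
rewrite big_split/= prodr_const card_ord -expR_sum.
rewrite /maxwellian -/T -/u -mulrA; congr (_ * (_ * expR _)).
  rewrite /normal_peak sqr_sqrtr ?ltW// exprVn; congr _^-1.
  have pT0 : 0 <= 2 * pi * T.
    by apply: mulr_ge0 (ltW T0); apply: mulr_ge0 (pi_ge0 _).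
  rewrite (_ : T * pi *+ 2 = 2 * pi * T); last by ring.
  by rewrite -powR12_sqrt// -powR_mulrn ?powR_ge0// -powRrM (mulrC _^-1).
rewrite /eucl_dist (sqr_sqrtr (ltW T0)) sqr_sqrtr; last first.
  by apply: sumr_ge0 => i _; exact: sqr_ge0.
rewrite mulr_suml -sumrN; apply: eq_bigr => i _.
by rewrite mulNr -[T *+ 2]mulr_natl.
Qed.

Lemma maxwellian_ge0 (R : realType) (n : nat) (f : n.-tuple R -> R)
    (v : n.-tuple R) : 0 <= mass f -> 0 <= maxwellian f v.
Proof.
by move=> f0; rewrite /maxwellian mulr_ge0 ?expR_ge0// divr_ge0// powR_ge0.
Qed.

Lemma integrable_maxwellian (R : realType) (n : nat) (f : n.-tuple R -> R) :
  maxwellian_defined f ->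
  (lebesgue R n).-integrable setT (EFin \o maxwellian f).
Proof.
move=> [_ [[f0 _ _]|[_ T0]]].
  rewrite (_ : _ \o _ = cst 0%E); first exact: integrable0.
  by apply/funext => v /=; rewrite /maxwellian f0 !mul0r.
rewrite (_ : _ \o _ = fun v => ((mass f)%:E *
   (\prod_(i < n) normal_pdf (tnth (bulk_velocity f) i)
      (Num.sqrt (temperature f)) (tnth v i))%:E)%E).
  by apply: integrableZl => //; exact: integrable_prod_normal_pdf.
by apply/funext => v /=; rewrite maxwellian_prod_normal_pdf.
Qed.

Lemma mass_maxwellian (R : realType) (n : nat) (f : n.-tuple R -> R) :
  maxwellian_defined f -> mass (maxwellian f) = mass f.
Proof.
move=> [_ [[f0 _ _]|[_ T0]]].
  rewrite f0 /mass (_ : maxwellian f = cst 0) ?Rintegral_cst// ?mul0r//.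
  by apply/funext => v /=; rewrite /maxwellian f0 !mul0r.
rewrite {1}/mass; under eq_Rintegral do rewrite maxwellian_prod_normal_pdf//.
rewrite RintegralZl//; last exact: integrable_prod_normal_pdf.
by rewrite /Rintegral integral_prod_normal_pdf mulr1.
Qed.

(* Integrating the hypothesis bounds the mass of [f] from below, which fixes the
   sign of its Maxwellian. *)
Lemma ge0_of_maxwellian_le (R : realType) (n : nat) (f : n.-tuple R -> R) (w : R) :
  0 <= w -> maxwellian_defined f ->
  (forall v, w * maxwellian f v <= (1 + w) * f v) -> forall v, 0 <= f v.
Proof.
move=> w0 Mf le_Mf.
have iM := integrable_maxwellian Mf.
have ifn : (lebesgue R n).-integrable setT (EFin \o f) by case: Mf => -[].
have f0 : 0 <= mass f.
  have : w * mass (maxwellian f) <= (1 + w) * mass f.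
    rewrite /mass -!RintegralZl//; apply: le_Rintegral => //.
    - exact: integrableZl iM.
    - exact: integrableZl ifn.
  (* Since M[f] and f have the same mass m, the inequality reads w m <= (1 + w) m, that is, 0 <=
     m. *)
  by rewrite mass_maxwellian//; lra.
move=> v; rewrite -(pmulr_rge0 _ (ltr_pwDl ltr01 w0)).
by apply: le_trans (le_Mf v); rewrite mulr_ge0// maxwellian_ge0.
Qed.

Theorem theorem4p1 (R : realType) (d : nat)
    (B : R -> d.+1.-tuple R -> R) (hB : conservative B)
    (eps beta dt : R) (heps : 0 < eps) (hbeta : 0 < beta) (hdt : 0 < dt)
    (c : nat -> R) (hc0 : c 0%N = 0) (hc1 : c 1%N = 0)
    (a : 'cV[R]_2) (Ah At : 'M[R]_2)
    (hAh : forall i j : 'I_2, (i <= j)%N -> Ah i j = 0)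
    (hAt : forall i j : 'I_2, (i < j)%N -> At i j = 0)
    (hAt_inv : At \in unitmx)
    (fn f1 f2 f3 fnext : R -> d.+1.-tuple R -> R)
    (hQ1 : forall x, boltzmann_defined B (f1 x))
    (hQ2 : forall x, boltzmann_defined B (f2 x))
    (hM1 : forall x, maxwellian_defined (f1 x))
    (hM2 : forall x, maxwellian_defined (f2 x))
    (hM3 : forall x, maxwellian_defined (f3 x))
    (hP1 : penalization_admissible B beta f1)
    (hP2 : penalization_admissible B beta f2)
    (hf1 : f1 = fn)
    (hf2 : forall x v,
       f2 x v = transport_shift c dt 2 0 fn x v
         + dt / eps * a 0 0 * transport_shift c dt 2 1 (fun y => G_P B beta (f1 y)) x v
         + dt / eps * At 0 0 * Q_P beta (f2 x) v)
    (hf3 : forall x v,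
       f3 x v = transport_shift c dt 3 0 fn x v
         + dt / eps * a 1 0 * transport_shift c dt 3 1 (fun y => G_P B beta (f1 y)) x v
         + dt / eps * Ah 1 0 * transport_shift c dt 3 2 (fun y => G_P B beta (f2 y)) x v
         + dt / eps * At 1 0 * transport_shift c dt 3 2 (fun y => Q_P beta (f2 y)) x v
         + dt / eps * At 1 1 * Q_P beta (f3 x) v)
    (hfnext : fnext = f3)
    (hfn : nonneg fn)
    (hGn : nonneg (fun x => G_P B beta (fn x))) :
  let z := beta * dt / eps in
  [/\ 0 <= a 0 0, 0 < At 0 0, 0 <= Ah 1 0 & 0 < At 1 1] ->
  [/\ 0 <= 1 - z * At 1 0 / (1 + z * At 0 0),
      0 <= a 1 0 - z * At 1 0 * a 0 0 / (1 + z * At 0 0) &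
      0 <= - Ah 1 0 + At 1 0 - z * At 1 0 * At 0 0 / (1 + z * At 0 0)] ->
  nonneg fnext.
Proof.
move=> z [a1 At11 Ah21 At22] [cfn cG cM].
subst f1 fnext.
have k0 : 0 < dt / eps by rewrite divr_gt0.
have zE : z = beta * (dt / eps) by rewrite /z mulrA.
have z0 : 0 < z by rewrite zE mulr_gt0.
have zAt11 : 0 < z * At 0 0 by rewrite mulr_gt0.
have zAt22 : 0 < z * At 1 1 by rewrite mulr_gt0.
have D0 : 1 + z * At 0 0 != 0 by rewrite gt_eqF// ltr_pwDl// ltW.
(* The loss part of [Q_P] moves to the left, which gives the shape required by
   [ge0_of_maxwellian_le] with w = z [At 0 0]. *)
have f2E x v : (1 + z * At 0 0) * f2 x v =
    transport_shift c dt 2 0 fn x v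
    + dt / eps * a 0 0 * transport_shift c dt 2 1 (fun y => G_P B beta (fn y)) x v
    + z * At 0 0 * maxwellian (f2 x) v.
  by rewrite mulrDl mul1r {1}hf2 /Q_P zE; ring.
have f2_ge0 : nonneg f2.
  move=> x; apply: (@ge0_of_maxwellian_le _ _ _ (z * At 0 0)) => //.
    exact: ltW.
  move=> v; rewrite f2E lerDr addr_ge0//; first exact: hfn.
  by rewrite mulr_ge0 ?(mulr_ge0 (ltW k0))//; exact: hGn.
have M2_ge0 x v : 0 <= maxwellian (f2 x) v.
  apply: maxwellian_ge0; apply: Rintegral_ge0 => w _; exact: f2_ge0.
(* Admissibility of beta at [f2] is conditional on [f2] >= 0, hence the second stage is settled
   first. *)
have P2_ge0 := hP2 f2_ge0.
move=> x; apply: (@ge0_of_maxwellian_le _ _ _ (z * At 1 1)) => //.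
  exact: ltW.
move=> v.
(* [y] is the foot at stage 2 of the characteristic through x at stage 3. Since v is constant along
   it, shifts compose: going from 3 to 2 and then from 2 to j is the shift from 3 to j, for j = 0,
   1. *)
set y := x - (c 3%N - c 2%N) * thead v * dt.
have y20 : y - (c 2%N - c 0%N) * thead v * dt = x - (c 3%N - c 0%N) * thead v * dt.
  by rewrite /y; ring.
have y21 : y - (c 2%N - c 1%N) * thead v * dt = x - (c 3%N - c 1%N) * thead v * dt.
  by rewrite /y; ring.
(* The term in [At 1 0] contains -[f2 y], whose sign is unfavourable when [At 1 0] > 0. Reading the
   second stage at [y] replaces it by the shifted data already present in the third stage. *)
have f2yE : f2 y v = (transport_shift c dt 3 0 fn x v
    + dt / eps * a 0 0 * transport_shift c dt 3 1 (fun y => G_P B beta (fn y)) x v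
    + z * At 0 0 * maxwellian (f2 y) v) / (1 + z * At 0 0).
  rewrite /transport_shift -y20 -y21; apply: (canRL (mulfK D0)).
  by rewrite mulrC f2E.
(* Writing G_P(f2) = P(f2) - beta M[f2] puts -[Ah 1 0] into the coefficient of M[f2]; the
   elimination of [f2 y] produces the three fractions over 1 + z [At 0 0]. *)
have f3E : (1 + z * At 1 1) * f3 x v =
    (1 - z * At 1 0 / (1 + z * At 0 0)) * transport_shift c dt 3 0 fn x v
    + dt / eps * (a 1 0 - z * At 1 0 * a 0 0 / (1 + z * At 0 0))
      * transport_shift c dt 3 1 (fun y => G_P B beta (fn y)) x v
    + dt / eps * Ah 1 0 * P_op B beta (f2 y) v
    + z * (- Ah 1 0 + At 1 0 - z * At 1 0 * At 0 0 / (1 + z * At 0 0))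
      * maxwellian (f2 y) v
    + z * At 1 1 * maxwellian (f3 x) v.
  have G2E : transport_shift c dt 3 2 (fun y => G_P B beta (f2 y)) x v
      = P_op B beta (f2 y) v - beta * maxwellian (f2 y) v.
    by rewrite /transport_shift -/y /G_P /P_op /Q_P; ring.
  have Q2E : transport_shift c dt 3 2 (fun y => Q_P beta (f2 y)) x v
      = beta * (maxwellian (f2 y) v - f2 y v) by [].
  rewrite mulrDl mul1r {1}hf3 G2E Q2E f2yE [Q_P _ (f3 x) _]/Q_P.
  (* Once dt / eps is abstracted as [k], the only denominator left is 1 + beta k [At 0 0], nonzero
     by [D0]. *)
  move: D0; rewrite zE.
  move: (dt / eps) => k D0.
  move: (maxwellian _ _) (P_op _ _ _ _) (transport_shift _ _ _ _ _ _ _).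
  by move=> *; field.
(* The M[f3] term cancels. The remaining terms carry fn, G_P(fn), P(f2) and M[f2], with coefficients
   signed by [cfn], [cG], [Ah21] and [cM] respectively. *)
rewrite f3E lerDr !addr_ge0//.
- by rewrite mulr_ge0//; exact: hfn.
- by rewrite mulr_ge0 ?(mulr_ge0 (ltW k0))//; exact: hGn.
- by rewrite mulr_ge0 ?(mulr_ge0 (ltW k0))//; exact: P2_ge0.
- by rewrite mulr_ge0// mulr_ge0// ltW.
Qed.
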